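(* Let the input/output data $(u_j)_{j\in\mathbb{N}}$, $(y_j)_{j\in\mathbb{N}}$ (real scalar sequences indexed by $j=0,1,2,\ldots$) be generated from a causal, bounded-input/bounded-output (BIBO) stable, linear time-invariant single-input/single-output discrete-time dynamical system with zero initial condition, and let $(h_i)_{i\ge 0}$, $h_i\in\mathbb{R}$, be its impulse response, so that $y_j=\sum_{i=0}^{j} h_i u_{j-i}$ for all $j$ and for every input sequence. For $j\ge 0$ let $H_j(z)=\sum_{i=0}^{j} h_i z^{-i}$, and let $H(z)=\sum_{i=0}^{\infty} h_i z^{-i}$ be the transfer function (a priori a formal power series). Then $$\lim_{j\to\infty} H_j(z) = H(z)\qquad\text{for all } z\in\mathbb{S}:=\{z\in\mathbb{C}\mid |z|=1\};$$ that is, for every $z\in\mathbb{S}$ the series defining $H(z)$ converges in $\mathbb{C}$ and the partial sums $H_j(z)$ converge to its value.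
   Context: Index convention: $j=0,1,2,\ldots$. A causal linear time-invariant single-input/single-output discrete-time system with zero initial condition maps a real input sequence $(u_j)_{j\ge0}$ to the real output sequence $(y_j)_{j\ge0}$ given by convolution with its impulse response: there exist numbers $h_i\in\mathbb{R}$ ($i\ge 0$) with $y_j=\sum_{i=0}^{j}h_i u_{j-i}$ for all $j\ge 0$. The system is called bounded-input/bounded-output (BIBO) stable if the output sequence $(y_j)_{j\ge0}$ is bounded for every bounded input sequence $(u_j)_{j\ge0}$. The transfer function $H$ is the formal power series $H(z)=\sum_{i=0}^{\infty}h_i z^{-i}$; it relates the Z-transforms $\hat u(z)=\sum_{i\ge0}u_i z^{-i}$ and $\hat y(z)=\sum_{i\ge0}y_i z^{-i}$ by $\hat y(z)=H(z)\hat u(z)$. The partial sums are $H_j(z)=\sum_{i=0}^{j}h_i z^{-i}$. *)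

(* Defs.v *)
From Stdlib Require Import Reals.
From Coquelicot Require Import Coquelicot.

Open Scope R_scope.

Definition signal := nat -> R.

Definition bounded_signal (u : signal) : Prop :=
  exists M : R, forall j : nat, Rabs (u j) <= M.

(* A discrete-time system with zero initial condition is its input/output map. *)
Definition system := signal -> signal.

Definition impulse_response (G : system) (h : signal) : Prop :=
  forall (u : signal) (j : nat),
    G u j = sum_n (fun i => h i * u (j - i)%nat) j.

Definition causal_LTI (G : system) : Prop :=
  exists h : signal, impulse_response G h.

Definition BIBO_stable (G : system) : Prop :=
  forall u : signal, bounded_signal u -> bounded_signal (G u).

(* The formal power series H is its coefficient sequence h; this is its term
   of index i at a complex number z. *)
Definition transfer_term (h : signal) (z : C) (i : nat) : C :=
  (RtoC (h i) * / z ^ i)%C.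

Definition transfer_partial (h : signal) (j : nat) (z : C) : C :=
  sum_n (transfer_term h z) j.

(* Like Coquelicot's other total operators, [lim] returns an arbitrary value on
   a divergent filter, so this is the value H(z) only where the series
   converges. *)
Definition transfer_function (h : signal) (z : C) : C :=
  lim (T := C_CompleteNormedModule)
    (filtermap (sum_n (transfer_term h z)) eventually).

(* Main.v *)
Require Import Defs.
From Stdlib Require Import Reals Lra Lia Classical ClassicalEpsilon.
From Coquelicot Require Import Coquelicot.

(** The point is that a BIBO stable system has an absolutely summable impulse
    response; on the unit circle [h i * z ^ (- i)] has modulus [Rabs (h i)], so
    the transfer function then converges absolutely there.

    Absolute summability is a uniform boundedness statement, proved here by a
    gliding hump.  A unit impulse as input shows [Rabs (h i) <= M] for some [M].
    If the sums of [Rabs (h i)] diverge, time is cut into consecutive blocks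
    [n + 1 .. n + l + 1] and the input is chosen on each block as the time
    reversed sign of [h], so that at the last time of the block the block
    contributes [Rabs (h 0) + ... + Rabs (h l)] to the output.  The [n + 1]
    earlier inputs, of modulus at most 1, can cancel at most [(n + 1) * M], and
    by divergence [l] can be taken so large that the output is still at least
    [n].  The resulting input is bounded by 1 while its output is unbounded:
    this is [resonant_output_unbounded], and [BIBO_stable_abs_summable] draws
    the conclusion. *)

Lemma sum_n_ge_prefix (f : nat -> R) (M : R) (l p : nat) :
  (forall i, Rabs (f i) <= M) ->
  sum_n f l - INR p * M <= sum_n f (l + p).
Proof.
  intros Hf. induction p as [|p IH].
  - rewrite Nat.add_0_r. simpl. lra.
  - rewrite Nat.add_succ_r, sum_Sn, S_INR.
    change plus with Rplus.
    assert (H := Hf (S (l + p))). apply Rabs_le_between in H. lra.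
Qed.

Lemma mult_sign_Rabs (x : R) : x * sign x = Rabs x.
Proof.
  destruct (Rtotal_order x 0) as [H | [-> | H]].
  - rewrite (sign_eq_m1 x H), (Rabs_left x H). ring.
  - rewrite sign_0, Rabs_R0. ring.
  - rewrite (sign_eq_1 x H), (Rabs_right x) by lra. ring.
Qed.

Lemma Rabs_sign_le_1 (x : R) : Rabs (sign x) <= 1.
Proof.
  destruct (Rtotal_order x 0) as [H | [-> | H]].
  - rewrite (sign_eq_m1 x H). apply Rabs_le. lra.
  - rewrite sign_0. apply Rabs_le. lra.
  - rewrite (sign_eq_1 x H). apply Rabs_le. lra.
Qed.

Lemma not_ex_series_unbounded (a : nat -> R) :
  (forall i, 0 <= a i) -> ~ ex_series a ->
  forall B : R, exists l : nat, B <= sum_n a l.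
Proof.
  intros Ha Hdiv B. apply NNPP. intros Hno. apply Hdiv.
  destruct (ex_finite_lim_seq_incr (sum_n a) B) as [s Hs].
  - intros n. rewrite sum_Sn. change plus with Rplus.
    specialize (Ha (S n)). lra.
  - intros n. apply Rnot_lt_le. intros Hlt. apply Hno. exists n. lra.
  - exists s. exact Hs.
Qed.

(** [block_end len m] is the last time of the block containing time [m], when
    the first block is time 0 alone and the block following time [n] has
    [S (len n)] elements.  The ends of blocks are the fixed points. *)
Fixpoint block_end (len : nat -> nat) (m : nat) : nat :=
  match m with
  | O => O
  | S m' => if Nat.eqb (block_end len m') m' then m' + S (len m')
            else block_end len m'
  end.

Lemma block_end_in_block (len : nat -> nat) (n i : nat) :
  block_end len n = n -> (i <= len n)%nat ->
  block_end len (n + S i) = (n + S (len n))%nat.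
Proof.
  intros Hn. induction i as [|i IH]; intros Hi.
  - rewrite Nat.add_1_r. simpl. rewrite Hn, Nat.eqb_refl. reflexivity.
  - rewrite Nat.add_succ_r. simpl. rewrite IH by lia.
    destruct (Nat.eqb_spec (n + S (len n)) (n + S i)); [lia | reflexivity].
Qed.

Lemma block_end_fixpoints_unbounded (len : nat -> nat) (N : nat) :
  exists n, (N <= n)%nat /\ block_end len n = n.
Proof.
  induction N as [|N [n [HNn Hn]]].
  - exists O. split; [lia | reflexivity].
  - exists (n + S (len n))%nat. split; [lia |].
    apply block_end_in_block; [exact Hn | lia].
Qed.

(** Time reversal within each block makes the products [h i * u (j - i)] equal
    to [Rabs (h i)] when [j] is the end of the block. *)
Definition resonant_input (h : signal) (len : nat -> nat) : signal :=
  fun m => sign (h (block_end len m - m)%nat).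

Lemma resonant_output_ge (h : signal) (len : nat -> nat) (M : R) (n : nat) :
  (forall i, Rabs (h i) <= M) ->
  block_end len n = n ->
  sum_n (fun i => Rabs (h i)) (len n) - INR (S n) * M
  <= sum_n (fun i => h i * resonant_input h len (n + S (len n) - i)%nat)
       (n + S (len n)).
Proof.
  intros HM Hn.
  set (f := fun i => h i * resonant_input h len (n + S (len n) - i)%nat).
  replace (sum_n (fun i => Rabs (h i)) (len n)) with (sum_n f (len n)).
  - replace (n + S (len n))%nat with (len n + S n)%nat by lia.
    apply sum_n_ge_prefix. intros i. unfold f. rewrite Rabs_mult.
    assert (H1 := Rabs_sign_le_1
      (h (block_end len (n + S (len n) - i) - (n + S (len n) - i))%nat)).
    fold (resonant_input h len (n + S (len n) - i)%nat) in H1.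
    assert (H2 := Rabs_pos (h i)). specialize (HM i). nra.
  - apply sum_n_ext_loc. intros i Hi. unfold f, resonant_input.
    replace (n + S (len n) - i)%nat with (n + S (len n - i))%nat by lia.
    rewrite block_end_in_block by (exact Hn || lia).
    replace (n + S (len n) - (n + S (len n - i)))%nat with i by lia.
    apply mult_sign_Rabs.
Qed.

(** Divergence provides block lengths that beat the influence of the past, so
    the output at the end of the block following [n] is at least [n]. *)
Lemma resonant_output_unbounded (h : signal) (M : R) :
  (forall i, Rabs (h i) <= M) ->
  ~ ex_series (fun i => Rabs (h i)) ->
  exists u : signal, bounded_signal u /\
    ~ bounded_signal (fun j => sum_n (fun i => h i * u (j - i)%nat) j).
Proof.
  intros HM Hdiv.
  assert (Hlen : forall n : nat, { l : nat |
            INR n + INR (S n) * M <= sum_n (fun i => Rabs (h i)) l }).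
  { intros n. apply constructive_indefinite_description.
    apply not_ex_series_unbounded; [| exact Hdiv].
    intros i. apply Rabs_pos. }
  set (len := fun n => proj1_sig (Hlen n)).
  exists (resonant_input h len). split.
  - exists 1. intros m. apply Rabs_sign_le_1.
  - intros [B HB].
    destruct (INR_unbounded B) as [N HN].
    destruct (block_end_fixpoints_unbounded len N) as [n [HNn Hn]].
    apply le_INR in HNn.
    assert (Hlow := resonant_output_ge h len M n HM Hn).
    assert (Hl : INR n + INR (S n) * M <= sum_n (fun i => Rabs (h i)) (len n))
      by exact (proj2_sig (Hlen n)).
    specialize (HB (n + S (len n))%nat). apply Rabs_le_between in HB.
    cbv beta in HB. lra.
Qed.

Definition unit_impulse : signal := fun m => if Nat.eqb m 0 then 1 else 0.

Lemma convolution_unit_impulse (h : signal) (j : nat) :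
  sum_n (fun i => h i * unit_impulse (j - i)%nat) j = h j.
Proof.
  destruct j as [|j].
  - rewrite sum_O. unfold unit_impulse. simpl. ring.
  - rewrite sum_Sn, (sum_n_ext_loc _ (fun _ => 0)).
    + rewrite sum_n_const, Nat.sub_diag. unfold unit_impulse.
      change plus with Rplus. simpl Nat.eqb. cbv iota.
      rewrite Rmult_0_r, Rmult_1_r.
      apply Rplus_0_l.
    + intros i Hi. unfold unit_impulse.
      destruct (Nat.eqb_spec (S j - i) 0); [lia | apply Rmult_0_r].
Qed.

Lemma BIBO_stable_impulse_response_bounded (G : system) (h : signal) :
  BIBO_stable G -> impulse_response G h -> bounded_signal h.
Proof.
  intros Hstab Hh. destruct (Hstab unit_impulse) as [M HM].
  - exists 1. intros m. unfold unit_impulse.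
    destruct (Nat.eqb m 0); apply Rabs_le; lra.
  - exists M. intros j. specialize (HM j).
    rewrite Hh, convolution_unit_impulse in HM. exact HM.
Qed.

Lemma BIBO_stable_abs_summable (G : system) (h : signal) :
  BIBO_stable G -> impulse_response G h -> ex_series (fun i => Rabs (h i)).
Proof.
  intros Hstab Hh.
  destruct (BIBO_stable_impulse_response_bounded G h Hstab Hh) as [M HM].
  apply NNPP. intros Hdiv.
  destruct (resonant_output_unbounded h M HM Hdiv) as [u [Hu Hout]].
  apply Hout. destruct (Hstab u Hu) as [B HB].
  exists B. intros j. rewrite <- Hh. apply HB.
Qed.

Lemma Cmod_transfer_term (h : signal) (z : C) (i : nat) :
  Cmod z = 1 -> Cmod (transfer_term h z i) = Rabs (h i).
Proof.
  intros Hz.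
  assert (Hp : Cmod (z ^ i)%C = 1) by (rewrite Cmod_pow, Hz; apply pow1).
  unfold transfer_term. rewrite Cmod_mult, Cmod_R, Cmod_inv, Hp.
  - field.
  - apply Cmod_gt_0. rewrite Hp. lra.
Qed.

(** A convergent filter is Cauchy, so the total operator [lim] returns a
    genuine limit of it. *)
Lemma filterlim_lim_of_ex {V : CompleteNormedModule C_AbsRing} (f : nat -> V) :
  (exists l : V, filterlim f eventually (locally l)) ->
  filterlim f eventually (locally (lim (filtermap f eventually))).
Proof.
  intros [l Hl].
  assert (Hlim : forall eps : posreal,
            eventually (fun n => ball (lim (filtermap f eventually)) eps (f n))).
  { apply (complete_cauchy (filtermap f eventually)).
    - apply filtermap_proper_filter. apply eventually_filter.
    - intros eps. exists l. apply Hl. apply locally_ball. }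
  apply filterlim_locally. exact Hlim.
Qed.

Theorem theorem2p3 (G : system) (h u y : signal)
  (HLTI : causal_LTI G)
  (Hstab : BIBO_stable G)
  (Hh : impulse_response G h)
  (Hdata : forall j : nat, y j = G u j) :
  forall z : C, Cmod z = 1%R ->
    ex_series (K := C_AbsRing) (V := C_NormedModule) (transfer_term h z) /\
    filterlim (fun j : nat => transfer_partial h j z) eventually
      (locally (transfer_function h z)).
Proof.
  intros z Hz.
  assert (Hser : ex_series (K := C_AbsRing) (V := C_NormedModule)
                   (transfer_term h z)).
  { apply (ex_series_le (K := C_AbsRing) (V := C_CompleteNormedModule)
             (transfer_term h z) (fun i => Rabs (h i))).
    - intros i. change (Cmod (transfer_term h z i) <= Rabs (h i)).
      rewrite Cmod_transfer_term by exact Hz. apply Rle_refl.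
    - exact (BIBO_stable_abs_summable G h Hstab Hh). }
  split; [exact Hser |].
  exact (filterlim_lim_of_ex (V := C_CompleteNormedModule)
           (sum_n (transfer_term h z)) Hser).
Qed.
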